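(* Let $M\subset\mathbb{R}^m$ and $N\subset\mathbb{R}^n$ be semialgebraic sets. The rings $\mathcal{S}(N)$ and $\mathcal{S}(M)$ are isomorphic if and only if the semialgebraic sets $N$ and $M$ are semialgebraically homeomorphic.
   Context: A map $f:M\to\mathbb{R}^n$ on a semialgebraic set $M\subset\mathbb{R}^m$ is called semialgebraic if it is continuous and its graph is a semialgebraic subset of $\mathbb{R}^{m+n}$ (continuity is part of the definition). $\mathcal{S}(M)$ denotes the commutative unital ring of all (continuous) semialgebraic functions $M\to\mathbb{R}$ with pointwise operations. A semialgebraic homeomorphism is a semialgebraic map that is a homeomorphism (its inverse is then automatically semialgebraic); two semialgebraic sets are semialgebraically homeomorphic if there is a semialgebraic homeomorphism between them. *)

(* Defs.v *)
From HB Require Import structures.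
From mathcomp Require Import all_boot all_order all_algebra.
From mathcomp Require Import all_classical all_reals all_analysis.
From mathcomp Require Import polyrcf qe_rcf ordered_qelim.
From mathcomp Require mpoly.
(* The notations of mpoly clash with those of MathComp-Analysis:
   [mpoly n R] is the type written {mpoly R[n]} in multinomials, and
   [peval p x] below is p.@[x 0]. *)
Import -(notations) mpoly.

Set Implicit Arguments.
Unset Strict Implicit.
Unset Printing Implicit Defensive.

Import Order.TTheory GRing.Theory Num.Theory.
Import numFieldNormedType.Exports.

Local Open Scope classical_set_scope.
Local Open Scope ring_scope.

Definition peval (R : realType) n (p : mpoly n R) (x : 'rV[R]_n) : R :=
  meval (x 0) p.

(* Finite boolean combinations of polynomial equations and inequalities. *)
Inductive semialgebraic (R : realType) (n : nat) : set 'rV[R]_n -> Prop :=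
| sa_eq0 (p : mpoly n R) : semialgebraic [set x | peval p x = 0]
| sa_gt0 (p : mpoly n R) : semialgebraic [set x | 0 < peval p x]
| sa_setC A : semialgebraic A -> semialgebraic (~` A)
| sa_setI A B : semialgebraic A -> semialgebraic B -> semialgebraic (A `&` B)
| sa_setU A B : semialgebraic A -> semialgebraic B -> semialgebraic (A `|` B).

Record saset (R : realType) (n : nat) := SASet {
  saset_set :> set 'rV[R]_n;
  saset_semialgebraic : semialgebraic saset_set }.

(* R^m x R^n is identified with R^(m + n) through row_mx. *)
Definition graph (R : realType) m n (M : set 'rV[R]_m) (f : M -> 'rV[R]_n) :
  set 'rV[R]_(m + n) := range (fun x : M => row_mx (\val x) (f x)).

(* [M] has the subspace topology: it is coerced to [set_type M]. *)
Definition semialgebraic_map (R : realType) m n (M : set 'rV[R]_m)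
    (f : M -> 'rV[R]_n) : Prop :=
  continuous f /\ semialgebraic (graph f).

(* The graph of a real-valued function is taken in R^(m + 1), a real number
   being seen as a 1 x 1 matrix. *)
Definition semialgebraic_fun (R : realType) m (M : set 'rV[R]_m)
    (f : M -> R) : Prop :=
  continuous f /\ semialgebraic (graph (fun x => (f x)%:M : 'rV[R]_1)).

Definition semialgebraically_homeomorphic (R : realType) m n
    (M : set 'rV[R]_m) (N : set 'rV[R]_n) : Prop :=
  exists (h : M -> N) (k : N -> M),
    [/\ cancel h k, cancel k h, continuous h, continuous k
      & semialgebraic_map (fun x : M => \val (h x))].

(* Closure of semialgebraic sets under polynomial preimages and, through the
   quantifier elimination procedure of qe_rcf, under projections; this is what
   makes S(M) closed under the ring operations. *)
Section Closure.
Variable R : realType.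

Lemma sa_set0 n : semialgebraic (set0 : set 'rV[R]_n).
Proof.
rewrite (_ : set0 = [set x | 0 < peval 0 x]); first exact: sa_gt0.
by apply/seteqP; split=> x //=; rewrite /peval meval0 ltxx.
Qed.

Lemma sa_setT n : semialgebraic (setT : set 'rV[R]_n).
Proof. by rewrite -setC0; apply/sa_setC/sa_set0. Qed.

Lemma sa_preimage m n (g : 'I_n -> mpoly m R) (A : set 'rV[R]_n) :
  semialgebraic A ->
  semialgebraic [set x : 'rV[R]_m | A (\row_i peval (g i) x)].
Proof.
have comp (p : mpoly n R) (x : 'rV[R]_m) :
    peval p (\row_i peval (g i) x) = peval (comp_mpoly [tuple g i | i < n] p) x.
  rewrite /peval comp_mpoly_meval; apply: meval_eq => i.
  by rewrite mxE tnth_mktuple.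
elim=> {A} [p|p|A _ IH|A B _ IHA _ IHB|A B _ IHA _ IHB].
- under eq_set => x do rewrite /= comp.
  exact: sa_eq0.
- under eq_set => x do rewrite /= comp.
  exact: sa_gt0.
- exact: sa_setC.
- exact: sa_setI.
- exact: sa_setU.
Qed.

Definition env n (x : 'rV[R]_n) : seq R := [seq x 0 i | i <- enum 'I_n].

Lemma size_env n (x : 'rV[R]_n) : size (env x) = n.
Proof. by rewrite size_map size_enum_ord. Qed.

Lemma nth_env n (x : 'rV[R]_n) (i : 'I_n) : nth 0 (env x) i = x 0 i.
Proof. by rewrite (nth_map i) ?size_enum_ord // nth_ord_enum. Qed.

Lemma env_row_mx n (x : 'rV[R]_n) (t : R) :
  env (row_mx x (t%:M : 'rV_1)) = set_nth 0 (env x) n t.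
Proof.
apply: (@eq_from_nth _ 0).
  by rewrite size_set_nth !size_env addn1; symmetry; apply/maxn_idPl.
move=> i; rewrite size_env => lti; rewrite nth_set_nth /=.
rewrite (nth_env _ (Ordinal lti)) mxE; case: fintype.splitP => j /= ->.
  by rewrite nth_env (ltn_eqF (ltn_ord j)).
by rewrite ord1 addn0 eqxx mxE eqxx.
Qed.

Lemma term_of_mpoly n (p : mpoly n R) :
  exists t, forall x : 'rV[R]_n, GRing.eval (env x) t = peval p x.
Proof.
have sumP (I : Type) (s : seq I) (F : I -> 'rV[R]_n -> R) :
    (forall i, exists t, forall x, GRing.eval (env x) t = F i x) ->
    exists t, forall x, GRing.eval (env x) t = \sum_(i <- s) F i x.
  move=> H; elim: s => [|i s [t IH]].
    by exists (GRing.NatConst _ 0) => x; rewrite big_nil.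
  have [u Hu] := H i; exists (GRing.Add u t) => x.
  by rewrite big_cons /= Hu IH.
have prodP (I : Type) (s : seq I) (F : I -> 'rV[R]_n -> R) :
    (forall i, exists t, forall x, GRing.eval (env x) t = F i x) ->
    exists t, forall x, GRing.eval (env x) t = \prod_(i <- s) F i x.
  move=> H; elim: s => [|i s [t IH]].
    by exists (GRing.NatConst _ 1) => x; rewrite big_nil.
  have [u Hu] := H i; exists (GRing.Mul u t) => x.
  by rewrite big_cons /= Hu IH.
have [|t Ht] := sumP _ (msupp p)
    (fun m x => mcoeff m p * \prod_i x 0 i ^+ fun_of_multinom m i).
  move=> m.
  have [|t Ht] := prodP _ (index_enum 'I_n)
      (fun i x => x 0 i ^+ fun_of_multinom m i).
    move=> i; exists (GRing.Exp (GRing.Var _ i) (fun_of_multinom m i)) => x.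
    by rewrite /= nth_env.
  by exists (GRing.Mul (GRing.Const (mcoeff m p)) t) => x; rewrite /= Ht.
by exists t => x; rewrite Ht /peval mevalE.
Qed.

Lemma mpoly_of_term n (t : GRing.term R) : GRing.rterm t ->
  exists p : mpoly n R,
    forall x : 'rV[R]_n, GRing.eval (env x) t = peval p x.
Proof.
elim: t => //=.
- move=> i _; case: (ltnP i n) => [lti|lei].
    exists (mpolyX R (mnm1 (Ordinal lti))) => x.
    by rewrite (nth_env x (Ordinal lti)) /peval mevalXU.
  by exists 0 => x; rewrite nth_default ?size_env // /peval meval0.
- by move=> c _; exists (mpolyC n c) => x; rewrite /peval mevalC.
- move=> k _; exists (mpolyC n k%:R) => x; by rewrite /peval mevalC.
- move=> t IHt u IHu /andP[/IHt[p Hp] /IHu[q Hq]].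
  by exists (p + q) => x; rewrite Hp Hq /peval mevalD.
- by move=> t IHt /IHt[p Hp]; exists (- p) => x; rewrite Hp /peval mevalN.
- move=> t IHt k /IHt[p Hp].
  by exists (p *+ k) => x; rewrite Hp /peval mevalMn.
- move=> t IHt u IHu /andP[/IHt[p Hp] /IHu[q Hq]].
  by exists (p * q) => x; rewrite Hp Hq /peval mevalM.
- move=> t IHt k /IHt[p Hp].
  by exists (p ^+ k) => x; rewrite Hp /peval rmorphXn.
Qed.

Lemma formula_of_semialgebraic n (A : set 'rV[R]_n) :
  semialgebraic A -> exists f, forall x, A x <-> ord.holds (env x) f.
Proof.
elim=> {A} [p|p|A _ [f IH]|A B _ [f IHf] _ [g IHg]|A B _ [f IHf] _ [g IHg]].
- have [t Ht] := term_of_mpoly p.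
  by exists (ord.Equal t (GRing.NatConst _ 0)) => x; rewrite /= Ht.
- have [t Ht] := term_of_mpoly p.
  by exists (ord.Lt (GRing.NatConst _ 0) t) => x; rewrite /= Ht.
- by exists (ord.Not f) => x; rewrite /= -IH.
- by exists (ord.And f g) => x; rewrite /= -IHf -IHg.
- by exists (ord.Or f g) => x; rewrite /= -IHf -IHg.
Qed.

Lemma semialgebraic_formula n (f : ord.formula R) :
  semialgebraic [set x : 'rV[R]_n | ord.holds (env x) f].
Proof.
pose w i s := @wproj R i s.
pose g := ord.quantifier_elim w (ord.to_rform f).
have rf := ord.to_rform_rformula f.
have fg (x : 'rV[R]_n) : ord.holds (env x) f <-> ord.qf_eval (env x) g.
  rewrite -ord.to_rformP; apply: rwP.
  exact: ord.quantifier_elim_rformP (@wf_QE_wproj R) (@valid_QE_wproj R) _ _ rf.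
have := ord.quantifier_elim_wf (@wf_QE_wproj R) rf; rewrite -/w -/g.
rewrite (_ : mkset _ = [set x | ord.qf_eval (env x) g]); last first.
  by apply/seteqP; split=> x /= /fg.
elim: g {fg} => //=.
- case=> _.
    rewrite (_ : mkset _ = setT); first exact: sa_setT.
    by apply/seteqP; split.
  rewrite (_ : mkset _ = set0); first exact: sa_set0.
  by apply/seteqP; split.
- move=> t u /andP[/(mpoly_of_term n)[p Hp] /(mpoly_of_term n)[q Hq]].
  rewrite (_ : mkset _ = [set x | peval (p - q) x = 0]); first exact: sa_eq0.
  apply/seteqP; split=> x /=; rewrite Hp Hq /peval mevalB.
    by move=> /eqP ->; rewrite subrr.
  by move=> /eqP; rewrite subr_eq0.
- move=> t u /andP[/(mpoly_of_term n)[p Hp] /(mpoly_of_term n)[q Hq]].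
  rewrite (_ : mkset _ = [set x | 0 < peval (q - p) x]); first exact: sa_gt0.
  by apply/seteqP; split=> x /=; rewrite Hp Hq /peval mevalB subr_gt0.
- move=> t u /andP[/(mpoly_of_term n)[p Hp] /(mpoly_of_term n)[q Hq]].
  rewrite (_ : mkset _ = ~` [set x | 0 < peval (p - q) x]).
    exact/sa_setC/sa_gt0.
  apply/seteqP; split=> x /=; rewrite Hp Hq /peval mevalB subr_gt0.
    by move=> le /(le_lt_trans le); rewrite ltxx.
  by move/negP; rewrite -leNgt.
- move=> f1 IH1 f2 IH2 /andP[/andP[q1 q2] /andP[r1 r2]].
  rewrite (_ : mkset _ = [set x | ord.qf_eval (env x) f1] `&`
                         [set x | ord.qf_eval (env x) f2]).
    by apply: sa_setI; [apply: IH1; rewrite q1|apply: IH2; rewrite q2].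
  by apply/seteqP; split=> x /= /andP.
- move=> f1 IH1 f2 IH2 /andP[/andP[q1 q2] /andP[r1 r2]].
  rewrite (_ : mkset _ = [set x | ord.qf_eval (env x) f1] `|`
                         [set x | ord.qf_eval (env x) f2]).
    by apply: sa_setU; [apply: IH1; rewrite q1|apply: IH2; rewrite q2].
  by apply/seteqP; split=> x /= /orP.
- move=> f1 IH1 f2 IH2 /andP[/andP[q1 q2] /andP[r1 r2]].
  rewrite (_ : mkset _ = ~` [set x | ord.qf_eval (env x) f1] `|`
                         [set x | ord.qf_eval (env x) f2]).
    apply: sa_setU; last by apply: IH2; rewrite q2.
    by apply: sa_setC; apply: IH1; rewrite q1.
  apply/seteqP; split=> x /=.
    by case: (ord.qf_eval _ f1); [right|left].
  by case=> [/negP/negbTE ->|->] //; rewrite implybT.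
- move=> f1 IH1 /IH1 H.
  rewrite (_ : mkset _ = ~` [set x | ord.qf_eval (env x) f1]).
    exact: sa_setC.
  by apply/seteqP; split=> x /= /negP.
Qed.

Lemma sa_proj n (A : set 'rV[R]_(n + 1)) : semialgebraic A ->
  semialgebraic [set x : 'rV[R]_n | exists t : R, A (row_mx x (t%:M : 'rV_1))].
Proof.
move=> /formula_of_semialgebraic[f Af].
rewrite (_ : mkset _ = [set x | ord.holds (env x) (ord.Exists n f)]).
  exact: semialgebraic_formula.
apply/seteqP; split=> x /= [t] H; exists t.
  by rewrite -env_row_mx; apply/Af.
by apply/Af; rewrite env_row_mx.
Qed.

Lemma graph_funE m (M : set 'rV[R]_m) (f : M -> R) (z : 'rV[R]_(m + 1)) :
  graph (fun x => (f x)%:M : 'rV_1) z <->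
  exists2 x : M, lsubmx z = \val x & rsubmx z 0 0 = f x.
Proof.
split=> [[x _ <-]|[x zx fx]].
  by exists x; rewrite ?row_mxKl // row_mxKr mxE eqxx.
exists x => //; rewrite -[RHS]hsubmxK zx; congr row_mx.
by apply/rowP => i; rewrite ord1 fx !mxE eqxx.
Qed.

End Closure.

(* [safun M] is the ring S(M), a subring of the ring of all functions M -> R
   with pointwise operations. It is only a comPzRingType (1 = 0 is allowed):
   S(M) is the zero ring when M is empty. *)
Section SemialgebraicFunctions.
Variables (R : realType) (m : nat) (M : saset R m).

Definition safun_pred : {pred M -> R} := fun f => `[< semialgebraic_fun f >].

Record safun := SFun { safun_fun :> M -> R; safunP : safun_fun \in safun_pred }.

HB.instance Definition _ := [isSub for safun_fun].
HB.instance Definition _ := [Choice of safun by <:].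

Lemma safun_const_mem (c : R) : (fun=> c : R) \in safun_pred.
Proof.
apply/asboolP; split; first by move=> x; apply: cst_continuous.
pose pr (i : 'I_m) : mpoly (m + 1) R := mpolyX R (mnm1 (lshift 1 i)).
pose last : mpoly (m + 1) R := mpolyX R (mnm1 (rshift m ord0)).
have := sa_preimage pr (saset_semialgebraic M).
move=> /(sa_setI (sa_eq0 (last - mpolyC _ c))).
rewrite (_ : _ `&` _ = graph (fun x : M => c%:M : 'rV_1)) //.
have prE (z : 'rV[R]_(m + 1)) : \row_i peval (pr i) z = lsubmx z.
  by apply/rowP => i; rewrite !mxE /peval mevalXU.
apply/seteqP; split=> z.
  rewrite /= prE /peval mevalB mevalC mevalXU => -[/eqP zc Mz].
  apply/graph_funE; exists (SigSub (mem_set Mz)) => //.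
  by rewrite mxE; apply/eqP; rewrite -subr_eq0.
move=> /graph_funE[x zx zc]; split => /=.
  by move: zc; rewrite /peval mevalB mevalC mevalXU mxE => ->; rewrite subrr.
by rewrite prE zx; exact: set_valP.
Qed.

Lemma sa_graph_op (op : R -> R -> R) (Q : mpoly (m + 1 + 1 + 1) R) :
  (forall (x : 'rV_m) y u v,
    peval Q (row_mx (row_mx (row_mx x y%:M) u%:M) (v%:M : 'rV_1))
      = y - op u v) ->
  forall f g : M -> R,
  semialgebraic (graph (fun x => (f x)%:M : 'rV_1)) ->
  semialgebraic (graph (fun x => (g x)%:M : 'rV_1)) ->
  semialgebraic (graph (fun x => (op (f x) (g x))%:M : 'rV_1)).
Proof.
move=> QE f g.
pose X (k : 'I_(m + 1 + 1 + 1)) : mpoly (m + 1 + 1 + 1) R := mpolyX R (mnm1 k).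
pose pr k (i : 'I_(m + 1)) : mpoly (m + 1 + 1 + 1) R :=
  match fintype.split i with
  | inl j => X (lshift 1 (lshift 1 (lshift 1 j)))
  | inr _ => X k
  end.
have prE k (x : 'rV_m) (y u v w : R)
    (z := row_mx (row_mx (row_mx x y%:M) u%:M) (v%:M : 'rV_1)) :
    z 0 k = w -> \row_i peval (pr k i) z = row_mx x w%:M.
  move=> zk; apply/rowP => i; rewrite !mxE /pr.
  case: fintype.splitP => j _; rewrite /peval mevalXU ?zk; last by rewrite ord1 mxE eqxx.
  by rewrite /z !row_mxEl.
pose ku : 'I_(m + 1 + 1 + 1) := lshift 1 (rshift (m + 1) ord0).
pose kv : 'I_(m + 1 + 1 + 1) := rshift (m + 1 + 1) ord0.
move=> /(sa_preimage (pr ku)) Hf /(sa_preimage (pr kv)) Hg.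
have := sa_proj (sa_proj (sa_setI (sa_setI Hf Hg) (sa_eq0 Q))).
rewrite (_ : mkset _ = graph (fun x => (op (f x) (g x))%:M : 'rV_1)) //.
have gE (h : M -> R) (x : 'rV_m) (w : R) :
    graph (fun x => (h x)%:M : 'rV_1) (row_mx x w%:M) <->
    exists2 a : M, x = \val a & w = h a.
  rewrite graph_funE row_mxKl row_mxKr.
  by split=> -[a xa wa]; exists a => //; move: wa; rewrite mxE eqxx.
have zE (z : 'rV[R]_(m + 1)) :
    z = row_mx (lsubmx z) (rsubmx z 0 0)%:M.
  rewrite -[LHS]hsubmxK; congr row_mx.
  by apply/rowP => i; rewrite !ord1 !mxE eqxx.
apply/seteqP; split=> z /=; rewrite [z]zE; set x := lsubmx z; set y := rsubmx z 0 0.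
  move=> [u [v [[]]]].
  rewrite (prE ku x y u v u) ?(prE kv x y u v v) ?QE.
  - move=> /gE[a xa ua] /gE[b xb vb] /eqP; rewrite subr_eq0 => /eqP ->.
    apply/gE; exists a => //.
    by rewrite ua vb (_ : b = a) //; apply: val_inj; rewrite -xb.
  - by rewrite row_mxEr mxE eqxx.
  - by rewrite row_mxEl row_mxEr mxE eqxx.
move=> /gE[a xa ya]; exists (f a), (g a).
rewrite (prE ku x y (f a) (g a) (f a)) ?(prE kv x y (f a) (g a) (g a)) ?QE.
- by split; [split; apply/gE; exists a|rewrite ya subrr].
- by rewrite row_mxEr mxE eqxx.
- by rewrite row_mxEl row_mxEr mxE eqxx.
Qed.

Lemma safun_subring_closed : subring_closed safun_pred.
Proof.
pose X (k : 'I_(m + 1 + 1 + 1)) : mpoly (m + 1 + 1 + 1) R := mpolyX R (mnm1 k).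
pose y := X (lshift 1 (lshift 1 (rshift m ord0))).
pose u := X (lshift 1 (rshift (m + 1) ord0)).
pose v := X (rshift (m + 1 + 1) ord0).
split.
- exact: (safun_const_mem 1).
- move=> f g /asboolP[cf sf] /asboolP[cg sg]; apply/asboolP; split.
    by move=> x; apply: (@continuousB _ _ _ f g x (cf x) (cg x)).
  apply: (sa_graph_op (op := fun a b => a - b) (Q := y - (u - v))) => // *.
  rewrite /peval !mevalB !mevalXU !(row_mxEl, row_mxEr) !mxE /=.
  by rewrite ?eqxx ?mulr1n.
- move=> f g /asboolP[cf sf] /asboolP[cg sg]; apply/asboolP; split.
    by move=> x; apply: (@continuousM _ _ f g x (cf x) (cg x)).
  apply: (sa_graph_op (op := fun a b => a * b) (Q := y - u * v)) => // *.
  rewrite /peval mevalB mevalM !mevalXU !(row_mxEl, row_mxEr) !mxE /=.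
  by rewrite ?eqxx ?mulr1n.
Qed.

HB.instance Definition _ :=
  GRing.isSubringClosed.Build (M -> R) safun_pred safun_subring_closed.
HB.instance Definition _ :=
  GRing.SubChoice_isSubComPzRing.Build (M -> R) safun_pred safun
    safun_subring_closed.

Lemma safun0E (x : M) : (0 : safun) x = 0. Proof. by []. Qed.

Lemma safun1E (x : M) : (1 : safun) x = 1. Proof. by []. Qed.

Lemma safunNE (f : safun) (x : M) : (- f) x = - f x. Proof. by []. Qed.

Lemma safunDE (f g : safun) (x : M) : (f + g) x = f x + g x. Proof. by []. Qed.

Lemma safunME (f g : safun) (x : M) : (f * g) x = f x * g x. Proof. by []. Qed.

End SemialgebraicFunctions.

(* Main.v *)
Require Import Defs.
From HB Require Import structures.
From mathcomp Require Import all_boot all_order all_algebra.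
From mathcomp Require Import all_classical all_reals all_analysis.
From mathcomp Require mpoly.
Import -(notations) mpoly.

(** A semialgebraic set N is recovered from S(N) as the set of its characters,
    the ring homomorphisms S(N) -> R: each of them is the evaluation at exactly
    one point of N ([character_eval], [safun_separates]), so an isomorphism
    between the rings transports points to points.

    Two facts make every character chi an evaluation. On the constants, chi is
    a ring endomorphism of R, hence the identity ([real_rmorphism_id]), so chi
    is R-linear. Moreover a function in the kernel of chi has a zero,
    since a function without zeros is invertible in S(N)
    ([safun_inv_mem], [character_zero]). Given finitely many f_1, ..., f_r, the
    sum of the squares of f_i - chi f_i lies in the kernel, and a zero of it is
    a point a with chi f_i = f_i a for all i ([character_eval_seq]). If the
    coordinate functions are among the f_i they determine a, which is therefore
    the same point for every further function f.

    Applied to g |-> phi g x, this turns a ring homomorphism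
    phi : S(N) -> S(M) into a map k : M -> N with phi g = g \o k
    ([rmorphism_pullback]). The components of k are the images under phi of the
    coordinate functions of N, so k is a semialgebraic map. The inverse of phi
    yields a map N -> M in the same way, and the two maps are inverse to each
    other because the coordinate functions separate points.

    In the other direction, pulling back along a semialgebraic map k is a ring
    homomorphism; that g \o k is semialgebraic again is the stability of
    semialgebraic sets under projection ([sa_exists], [pullback_mem]). The
    graph of the inverse of a homeomorphism is the transposed graph, so both
    halves of a semialgebraic homeomorphism give pullbacks, and these are
    inverse to each other. *)

Set Implicit Arguments.
Unset Strict Implicit.
Unset Printing Implicit Defensive.

Import Order.TTheory GRing.Theory Num.Theory.
Import numFieldNormedType.Exports.

Local Open Scope classical_set_scope.
Local Open Scope ring_scope.

(** * Semialgebraic sets under changes of coordinates and projections *)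

Section SemialgebraicSets.
Variable R : realType.

Lemma sa_colsub m n (s : 'I_n -> 'I_m) (A : set 'rV[R]_n) :
  semialgebraic A -> semialgebraic [set x : 'rV[R]_m | A (colsub s x)].
Proof.
move=> /(sa_preimage (fun i => mpolyX R (mnm1 (s i)))).
congr semialgebraic; apply/seteqP; split=> x /=;
  by congr A; apply/rowP => i; rewrite !mxE /peval mevalXU.
Qed.

(** With a graph for [A], this is the condition that the coordinates of x chosen
    by [s] and those chosen by [t] are an argument of a map and its value. *)
Lemma sa_colsub_row m n p (s : 'I_n -> 'I_m) (t : 'I_p -> 'I_m)
    (A : set 'rV[R]_(n + p)) :
  semialgebraic A ->
  semialgebraic [set x : 'rV[R]_m | A (row_mx (colsub s x) (colsub t x))].
Proof.
pose u (i : 'I_(n + p)) :=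
  match fintype.split i with inl j => s j | inr j => t j end.
move=> /(sa_colsub u); congr semialgebraic; apply/seteqP; split=> x /=;
  by congr A; apply/rowP => i; rewrite !mxE /u; case: fintype.split => j;
     rewrite !mxE.
Qed.

Lemma sa_forall (I : finType) n (A : I -> set 'rV[R]_n) :
  (forall i, semialgebraic (A i)) ->
  semialgebraic [set x | forall i, A i x].
Proof.
move=> Asa.
have : forall s : seq I,
    semialgebraic [set x : 'rV[R]_n | forall i, i \in s -> A i x].
  elim=> [|i s IH].
    rewrite (_ : mkset _ = setT); first exact: sa_setT.
    by apply/seteqP; split.
  have := sa_setI (Asa i) IH; congr semialgebraic; apply/seteqP; split=> x /=.
    by move=> [Aix sx] j; rewrite inE => /predU1P[->//|/sx].
  move=> sx; split; first by apply: sx; rewrite inE eqxx.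
  by move=> j js; apply: sx; rewrite inE js orbT.
move=> /(_ (enum I)); congr semialgebraic; apply/seteqP; split=> x /= Ax i.
  by apply: Ax; rewrite mem_enum.
by move=> _; apply: Ax.
Qed.

(** The coordinates of [y] are projected away one at a time: splitting the first
    one off and regrouping n + (1 + p) as (n + 1) + p leaves [p] of them to the
    induction hypothesis, and the last step is the projection along a line. *)
Lemma sa_exists n p (A : set 'rV[R]_(n + p)) : semialgebraic A ->
  semialgebraic [set x : 'rV[R]_n | exists y : 'rV[R]_p, A (row_mx x y)].
Proof.
elim: p n A => [|p IH] n A Asa.
  have := sa_colsub (cast_ord (addn0 n)) Asa.
  congr semialgebraic; apply/seteqP; split=> x /=.
    move=> Ax; exists 0; move: Ax; congr A; apply/rowP => i.
    rewrite !mxE; case: fintype.splitP => [j ij|[]//].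
    by congr (x _ _); apply: val_inj.
  move=> [y]; congr A; apply/rowP => i.
  rewrite !mxE; case: fintype.splitP => [j ij|[]//].
  by congr (x _ _); apply: val_inj.
have castE (x : 'rV[R]_n) (t : 'rV[R]_1) (y : 'rV[R]_p) :
    colsub (cast_ord (addnA n 1 p)) (row_mx (row_mx x t) y) =
    row_mx x (row_mx t y).
  have castA := @row_mxA R 1 n 1 p x t y; rewrite [RHS]castA.
  by apply/rowP => i; rewrite mxE castmxE esymK cast_ord_id.
have := sa_proj (IH _ _ (sa_colsub (cast_ord (addnA n 1 p)) Asa)).
congr semialgebraic; apply/seteqP; split=> x /=.
  by move=> [t [y]]; rewrite castE => Ay; exists (row_mx (t%:M : 'rV_1) y).
move=> [y Ay]; exists ((lsubmx (y : 'rV_(1 + p))) 0 0).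
exists (rsubmx (y : 'rV_(1 + p))); rewrite castE.
by rewrite -(mx11_scalar (lsubmx (y : 'rV_(1 + p)))) hsubmxK.
Qed.

End SemialgebraicSets.

(** * Semialgebraic maps and functions *)

Lemma continuous_rV (R : realType) (T : topologicalType) n (f : T -> 'rV[R]_n) :
  (forall i, continuous (fun x => f x 0 i)) -> continuous f.
Proof.
move=> fc x A [P Pfx sPA].
have : \forall y \near x, forall i, P 0 i (f y 0 i).
  by apply: filter_forall => i; apply: fc; apply: Pfx.
apply: filterS => y Py; apply: sPA => i j; rewrite ord1; exact: Py.
Qed.

Section SemialgebraicMaps.
Variables (R : realType) (m : nat) (M : saset R m).

Lemma graphE n (f : M -> 'rV[R]_n) x y :
  graph f (row_mx x y) <-> exists2 a : M, x = \val a & y = f a.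
Proof.
split=> [[a _ /eq_row_mx[<- <-]]|[a -> ->]]; first by exists a.
by exists a.
Qed.

(** The graph of [f] is the set of all (x, y) such that (x, y_i) is in the graph
    of the i-th component for every [i]. The condition that x lies in [M] has
    to be added for the sake of [n = 0], where there are no components. *)
Lemma semialgebraic_map_rV n (f : M -> 'rV[R]_n) :
  (forall i, semialgebraic_fun (fun x => f x 0 i)) -> semialgebraic_map f.
Proof.
move=> fsa; split; first by apply: continuous_rV => i; case: (fsa i).
have Msa := sa_colsub (@lshift m n) (saset_semialgebraic M).
have Csa := sa_forall (fun i =>
  sa_colsub_row (@lshift m n) (fun=> rshift m i) (fsa i).2).
have := sa_setI Msa Csa; congr semialgebraic; apply/seteqP; split=> z /=.
  move=> [Mz Cz]; rewrite -(hsubmxK z); apply/graphE.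
  exists (SigSub (mem_set Mz)) => /=; first by apply/rowP => i; rewrite !mxE.
  apply/rowP => i; have /graphE[a za /rowP/(_ 0)] := Cz i.
  rewrite !mxE eqxx => ->; congr (f _ 0 i); exact: val_inj.
move=> [a _ <-].
have lE : colsub (lshift n) (row_mx (\val a) (f a)) = \val a.
  by apply/rowP => i; rewrite mxE row_mxEl.
rewrite lE; split=> [|i]; first exact: set_valP.
by apply/graphE; exists a => //; apply/rowP => j;
  rewrite ord1 mxE row_mxEr mxE eqxx.
Qed.

Lemma safun_coord_mem i : (fun x : M => \val x 0 i) \in @safun_pred _ _ M.
Proof.
apply/asboolP; split.
  move=> x; apply: (@continuous_comp _ _ _ (fun x : M => \val x)
    (fun v : 'rV_m => v 0 i)); first exact: initial_continuous.
  exact: coord_continuous.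
pose X k : mpoly (m + 1) R := mpolyX R (mnm1 k).
have := sa_setI (sa_colsub (@lshift m 1) (saset_semialgebraic M))
  (sa_eq0 (X (rshift m 0) - X (lshift 1 i))).
congr semialgebraic; apply/seteqP; split=> z.
  rewrite /= /peval mevalB !mevalXU => -[Mz /eqP].
  rewrite subr_eq0 => /eqP zE; apply/graph_funE.
  exists (SigSub (mem_set Mz)); first by apply/rowP => j; rewrite !mxE.
  by rewrite !mxE.
move=> /graph_funE[a za zi].
have lE : colsub (lshift 1) z = \val a.
  by rewrite -za; apply/rowP => j; rewrite !mxE.
split=> /=; first by rewrite lE; exact: set_valP.
rewrite /peval mevalB !mevalXU; apply/eqP; rewrite subr_eq0; apply/eqP.
by move: zi; rewrite -za !mxE.
Qed.

(** The point (x, y) is in the graph of 1/f if and only if some (x, t) in the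
    graph of f satisfies y t = 1. *)
Lemma safun_inv_mem (f : safun M) : (forall x, f x != 0) ->
  (fun x => (f x)^-1) \in @safun_pred _ _ M.
Proof.
move=> f0; have /asboolP[fc fsa] := safunP f; apply/asboolP; split.
  by move=> x; exact: (cvgV (f0 x) (fc x)).
pose X k : mpoly (m + 1 + 1) R := mpolyX R (mnm1 k).
have := sa_proj (sa_setI
  (sa_colsub_row (fun i => lshift 1 (lshift 1 i)) (@rshift (m + 1) 1) fsa)
  (sa_eq0 (X (lshift 1 (rshift m 0)) * X (rshift (m + 1) 0) - 1))).
congr semialgebraic.
have lE (z : 'rV[R]_(m + 1)) (t : R) :
    colsub (fun i => lshift 1 (lshift 1 i)) (row_mx z (t%:M : 'rV_1)) =
    lsubmx z.
  by apply/rowP => i; rewrite [LHS]mxE row_mxEl mxE.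
have rE (z : 'rV[R]_(m + 1)) (t : R) :
    colsub (@rshift (m + 1) 1) (row_mx z (t%:M : 'rV_1)) = t%:M.
  by apply/rowP => i; rewrite mxE row_mxEr.
have pE (z : 'rV[R]_(m + 1)) (t : R) :
    peval (X (lshift 1 (rshift m 0)) * X (rshift (m + 1) 0) - 1)
      (row_mx z (t%:M : 'rV_1)) = rsubmx z 0 0 * t - 1.
  rewrite /peval mevalB mevalM !mevalXU meval1.
  by rewrite row_mxEl row_mxEr !mxE eqxx.
apply/seteqP; split=> z /=.
  move=> [t []]; rewrite lE rE pE.
  move=> /graphE[a za /rowP/(_ 0)]; rewrite !mxE eqxx !mulr1n => ->.
  move/eqP; rewrite subr_eq0 => /eqP zf; apply/graph_funE; exists a => //.
  by apply: (mulIf (f0 a)); rewrite mulVf // -zf mxE.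
move=> /graph_funE[a za zf]; exists (f a); rewrite lE rE pE; split.
  by apply/graphE; exists a.
by rewrite zf mulVf ?subrr.
Qed.

End SemialgebraicMaps.

(** * Characters of the ring of semialgebraic functions *)

(** A ring endomorphism maps squares to squares, so it is monotone on a field
    where nonnegative elements are squares; it fixes the rationals, which are
    dense. *)
Lemma real_rmorphism_id (R : realType) (f : {rmorphism R -> R}) : f =1 id.
Proof.
have f_ge0 x : 0 <= x -> 0 <= f x.
  by move=> x0; rewrite -(sqr_sqrtr x0) rmorphXn sqr_ge0.
have f_le x y : x <= y -> f x <= f y.
  by move=> xy; rewrite -subr_ge0 -rmorphB f_ge0 // subr_ge0.
move=> x; apply/eqP; rewrite eq_le; apply/andP; split;
  rewrite leNgt; apply/negP.
  move=> /rat_in_itvoo[q /itvP qx].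
  have := f_le x (ratr q); rewrite fmorph_rat qx => /(_ isT).
  by rewrite leNgt qx.
move=> /rat_in_itvoo[q /itvP qx].
have := f_le (ratr q) x; rewrite fmorph_rat qx => /(_ isT).
by rewrite leNgt qx.
Qed.

Section Characters.
Variables (R : realType) (n : nat) (N : saset R n).

Definition safun_const (c : R) : safun N := SFun (safun_const_mem N c).

Lemma safun_const_zmod : zmod_morphism safun_const.
Proof. by move=> c d; apply: val_inj. Qed.
Lemma safun_const_monoid : monoid_morphism safun_const.
Proof. by split=> [|c d]; apply: val_inj. Qed.
HB.instance Definition _ :=
  GRing.isZmodMorphism.Build R (safun N) safun_const safun_const_zmod.
HB.instance Definition _ :=
  GRing.isMonoidMorphism.Build R (safun N) safun_const safun_const_monoid.

Definition safun_eval (a : N) (f : safun N) : R := f a.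

Lemma safun_eval_zmod a : zmod_morphism (safun_eval a).
Proof. by []. Qed.
Lemma safun_eval_monoid a : monoid_morphism (safun_eval a).
Proof. by []. Qed.
HB.instance Definition _ a :=
  GRing.isZmodMorphism.Build (safun N) R (safun_eval a) (safun_eval_zmod a).
HB.instance Definition _ a :=
  GRing.isMonoidMorphism.Build (safun N) R (safun_eval a) (safun_eval_monoid a).

Definition safun_coord i : safun N := SFun (safun_coord_mem N i).

Variable chi : {rmorphism safun N -> R}.

Lemma character_const c : chi (safun_const c) = c.
Proof. exact: (real_rmorphism_id (chi \o safun_const)). Qed.

(** Otherwise [f] is a unit, and ring homomorphisms send units to units. *)
Lemma character_zero f : chi f = 0 -> exists a, f a = 0.
Proof.
move=> chif; apply: contrapT => /forallNP f0.
have f_neq0 a : f a != 0 by apply/eqP.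
have : chi (f * SFun (safun_inv_mem f_neq0)) = 1.
  rewrite -(rmorph1 chi); congr (chi _); apply: val_inj.
  by apply/funext => a; rewrite -[LHS]/(f a / f a) divff.
by rewrite rmorphM chif mul0r => /esym/eqP; rewrite oner_eq0.
Qed.

(** Over the reals one equation expresses finitely many: the function to which
    [character_zero] is applied is a sum of squares. *)
Lemma character_eval_seq (s : seq (safun N)) :
  exists a, forall f, f \in s -> chi f = f a.
Proof.
have [|a] := @character_zero (\sum_(f <- s) (f - safun_const (chi f)) ^+ 2).
  rewrite rmorph_sum big1 // => f _.
  by rewrite rmorphXn rmorphB character_const subrr expr0n.
rewrite -[LHS]/(safun_eval a _) rmorph_sum => /eqP.
rewrite psumr_eq0 => [/allP sa|f _]; last by rewrite rmorphXn sqr_ge0.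
exists a => f /sa; rewrite implyTb rmorphXn sqrf_eq0 rmorphB subr_eq0.
by move=> /eqP.
Qed.

(** The point given by [character_eval_seq] for [f] and all the coordinate
    functions has the coordinates chi x_i, so it does not depend on [f]. *)
Lemma character_eval : exists a, forall f, chi f = f a.
Proof.
pose s := [seq safun_coord i | i <- enum 'I_n].
have sP i : safun_coord i \in s by rewrite map_f ?mem_enum.
have [a chia] := character_eval_seq s.
exists a => f; have [b chib] := character_eval_seq (f :: s).
rewrite chib ?mem_head //; congr (f _); apply/val_inj/rowP => i.
by rewrite -[LHS]/(safun_coord i b) -chib ?inE ?sP ?orbT // chia.
Qed.

End Characters.

(** * Ring homomorphisms and semialgebraic maps *)

Section Pullback.
Variables (R : realType) (m n : nat) (M : saset R m) (N : saset R n).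

Lemma rmorphism_pullback (phi : {rmorphism safun N -> safun M}) :
  exists k : M -> N, semialgebraic_map (fun x => \val (k x)) /\
    forall g x, phi g x = g (k x).
Proof.
have [k kP] := choice (fun x => character_eval (safun_eval x \o phi)).
have phiE g x : phi g x = g (k x) by rewrite -kP.
exists k; split=> //; apply: semialgebraic_map_rV => i.
rewrite (_ : (fun _ => _) = phi (safun_coord N i)); first exact/asboolP/safunP.
by apply/funext => x; rewrite phiE.
Qed.

Lemma safun_separates (x y : N) : (forall g : safun N, g x = g y) -> x = y.
Proof.
by move=> gE; apply/val_inj/rowP => i; apply: (gE (safun_coord N i)).
Qed.

(** The graph of [k] is the transposed graph of [h], and transposing a graph
    only permutes the coordinates. *)
Lemma semialgebraic_map_inverse (h : N -> M) (k : M -> N) :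
  cancel h k -> cancel k h -> continuous k ->
  semialgebraic_map (fun x => \val (h x)) ->
  semialgebraic_map (fun x => \val (k x)).
Proof.
move=> hk kh kc [_ hsa]; split.
  move=> x; apply: (@continuous_comp _ _ _ k (fun y : N => \val y)).
    exact: kc.
  exact: initial_continuous.
have := sa_colsub_row (@rshift m n) (@lshift m n) hsa.
congr semialgebraic; apply/seteqP; split=> z /=.
  have -> : colsub (@rshift m n) z = rsubmx z by apply/rowP => i; rewrite !mxE.
  have -> : colsub (@lshift m n) z = lsubmx z by apply/rowP => i; rewrite !mxE.
  move=> /graphE[b zr zl]; rewrite -(hsubmxK z) zr zl; apply/graphE.
  by exists (h b); rewrite ?hk.
move=> [a _ <-].
have -> : colsub (@rshift m n) (row_mx (\val a) (\val (k a))) = \val (k a).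
  by apply/rowP => i; rewrite mxE row_mxEr.
have -> : colsub (@lshift m n) (row_mx (\val a) (\val (k a))) = \val a.
  by apply/rowP => i; rewrite mxE row_mxEl.
by apply/graphE; exists (k a); rewrite ?kh.
Qed.

Variable k : M -> N.
Hypothesis k_sa : semialgebraic_map (fun x => \val (k x)).

Lemma semialgebraic_map_continuous : continuous k.
Proof. by apply: continuous_comp_initial; case: k_sa. Qed.

(** The graph of the composite is the projection of the set of all (x, t, y)
    with (x, y) in the graph of [k] and (y, t) in the graph of [g]. *)
Lemma pullback_mem (g : safun N) : g \o k \in @safun_pred _ _ M.
Proof.
have /asboolP[gc gsa] := safunP g; apply/asboolP; split.
  move=> x; apply: continuous_comp; last exact: gc.
  exact: semialgebraic_map_continuous.
have := sa_exists (sa_setI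
  (sa_colsub_row (fun i => lshift n (lshift 1 i)) (@rshift (m + 1) n) k_sa.2)
  (sa_colsub_row (@rshift (m + 1) n) (fun i => lshift n (rshift m i)) gsa)).
congr semialgebraic.
have yE (z : 'rV[R]_(m + 1)) (y : 'rV[R]_n) :
    colsub (@rshift (m + 1) n) (row_mx z y) = y.
  by apply/rowP => i; rewrite mxE row_mxEr.
have lE (z : 'rV[R]_(m + 1)) (y : 'rV[R]_n) :
    colsub (fun i => lshift n (lshift 1 i)) (row_mx z y) = lsubmx z.
  by apply/rowP => i; rewrite [LHS]mxE row_mxEl mxE.
have rE (z : 'rV[R]_(m + 1)) (y : 'rV[R]_n) :
    colsub (fun i => lshift n (rshift m i)) (row_mx z y) = rsubmx z.
  by apply/rowP => i; rewrite [LHS]mxE row_mxEl mxE.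
apply/seteqP; split=> z /=.
  move=> [y []]; rewrite yE lE rE => /graphE[a za ya] /graphE[b yb zb].
  rewrite -(hsubmxK z); apply/graphE; exists a => //.
  by rewrite zb; congr ((g _)%:M); apply: val_inj; rewrite -yb.
move=> [a _ <-]; exists (\val (k a)); rewrite yE lE rE row_mxKl row_mxKr.
by split; apply/graphE; [exists a|exists (k a)].
Qed.

Definition pullback (g : safun N) : safun M := SFun (pullback_mem g).

Lemma pullback_zmod : zmod_morphism pullback.
Proof. by move=> f g; apply: val_inj. Qed.
Lemma pullback_monoid : monoid_morphism pullback.
Proof. by split=> [|f g]; apply: val_inj. Qed.
HB.instance Definition _ :=
  GRing.isZmodMorphism.Build (safun N) (safun M) pullback pullback_zmod.
HB.instance Definition _ :=
  GRing.isMonoidMorphism.Build (safun N) (safun M) pullback pullback_monoid.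

End Pullback.

Lemma pullback_cancel (R : realType) (m n : nat) (M : saset R m)
    (N : saset R n) (h : N -> M) (k : M -> N)
    (h_sa : semialgebraic_map (fun x => \val (h x)))
    (k_sa : semialgebraic_map (fun x => \val (k x))) :
  cancel h k -> cancel (pullback k_sa) (pullback h_sa).
Proof. by move=> hk g; apply/val_inj/funext => y /=; rewrite hk. Qed.

Theorem theorem1 (R : realType) (m n : nat) (M : saset R m) (N : saset R n) :
  (exists phi : {rmorphism safun N -> safun M}, bijective phi) <->
  semialgebraically_homeomorphic N M.
Proof.
split=> [[phi [psi phiK psiK]]|[h [k [hk kh h_cont k_cont h_sa]]]]; last first.
  have k_sa := semialgebraic_map_inverse hk kh k_cont h_sa.
  exists (pullback k_sa); exists (pullback h_sa); exact: pullback_cancel.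
pose psi_zmod := GRing.isZmodMorphism.Build (safun M) (safun N) psi
  (can2_zmod_morphism phiK psiK).
pose psi_monoid := GRing.isMonoidMorphism.Build (safun M) (safun N) psi
  (can2_monoid_morphism phiK psiK).
pose psi' : {rmorphism safun M -> safun N} := HB.pack psi psi_zmod psi_monoid.
have [k [k_sa phiE]] := rmorphism_pullback phi.
have [h [h_sa psiE]] := rmorphism_pullback psi'.
exists h, k; split=> //; try exact: semialgebraic_map_continuous.
  by move=> y; apply: safun_separates => g; rewrite -phiE -psiE /= phiK.
by move=> x; apply: safun_separates => f; rewrite -psiE -phiE /= psiK.
Qed.
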